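(* Let $G$ be a simple connected graph with $n$ nodes and $m\ge1$ edges, let $q$ be a positive integer, and let $R_q(G)$ be the $q$-triangulation graph of $G$. Then Kemeny's constant satisfies $$K(R_q(G))=\frac{4q+2}{q+2}K(G)+\frac{q^2+(4n-1)q+2n}{(q+2)(2q+1)}+mq-n.$$
   Context: For a positive integer $q$, the $q$-triangulation graph $R_q(G)$ is obtained from $G$ by keeping all nodes and edges of $G$ and adding, for each edge $uv$ of $G$, $q$ disjoint paths of length $2$: $ux_1v,\dots,ux_qv$, where $x_1,\dots,x_q$ are new nodes. For a simple connected graph with $m$ edges and degrees $d_i$, consider the simple unbiased random walk (from $i$ to each neighbor with probability $1/d_i$), with stationary distribution $\pi_i=d_i/2m$; $T_{ij}$ is the expected number of steps to first reach $j$ from $i$ ($T_{ii}=0$). Kemeny's constant is $K(G)=\sum_{j}\pi_jT_{ij}$, which is independent of $i$; it equals $\sum_{i=2}^n\frac1{1-\lambda_i}$, where $1=\lambda_1>\lambda_2\ge\cdots\ge\lambda_n$ are the eigenvalues of the normalized adjacency matrix $D^{-1/2}AD^{-1/2}$ ($A$ adjacency matrix, $D$ diagonal degree matrix). *)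

(* Defs.v *)
(* MathComp world, with MathComp-Analysis for infinite sums in \bar R. *)
From mathcomp Require Import all_boot all_order all_algebra.
From mathcomp Require Import all_classical all_reals all_analysis.

Set Implicit Arguments.
Unset Strict Implicit.
Unset Printing Implicit Defensive.

Import Order.TTheory GRing.Theory Num.Theory.

Local Open Scope ring_scope.

(* A simple graph on V is a symmetric irreflexive adjacency relation e. *)
Section Graphs.
Variables (V : finType) (e : rel V).

Definition edge_set : {set {set V}} :=
  [set [set p.1; p.2] | p : V * V & e p.1 p.2].

Definition degree (x : V) : nat := #|[set y | e x y]|.

Definition connected_graph : Prop := forall x y : V, connect e x y.

(* The node inr (E, a) is the midpoint of the a-th new path of length 2 joining
   the two ends of the edge E. *)
Definition qtri_node (q : nat) : finType :=
  (V + {E : {set V} | E \in edge_set} * 'I_q)%type.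

Definition qtri (q : nat) : rel (qtri_node q) := fun x y =>
  match x, y with
  | inl u, inl v => e u v
  | inl u, inr (E, _) => u \in val E
  | inr (E, _), inl u => u \in val E
  | inr _, inr _ => false
  end.

End Graphs.

Arguments qtri {V} e q x y.

Section RandomWalk.
Variables (R : realType) (V : finType) (e : rel V).

Definition walk_step (x y : V) : R :=
  if e x y then (degree e x)%:R^-1 else 0.

Definition stationary (x : V) : R :=
  (degree e x)%:R / (2 * #|edge_set e|%:R).

(* Probability that the walk started at i is at j for the first time at time k,
   as a sum over the trajectories i, w_1, ..., w_k: [index j (i :: w) == k] says
   that the last node is j and that no earlier one is. *)
Definition first_passage (i j : V) (k : nat) : R :=
  \sum_(w : k.-tuple V | index j (i :: w) == k)
     \prod_(t < k) walk_step (nth i (i :: w) t) (tnth w t).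

Local Open Scope ereal_scope.

Definition never_reach (i j : V) : \bar R :=
  1 - \sum_(0 <= k <oo) (first_passage i j k)%:E.

(* Expectation of the first hitting time of j, which takes the value +oo with
   probability [never_reach i j]; recall that +oo * 0 = 0 in \bar R. *)
Definition hitting_time (i j : V) : \bar R :=
  \sum_(0 <= k <oo) (k%:R * first_passage i j k)%:E + +oo * never_reach i j.

(* Kemeny's constant computed from the starting node i. *)
Definition kemeny (i : V) : \bar R :=
  \sum_(j : V) (stationary j)%:E * hitting_time i j.

End RandomWalk.

Arguments walk_step R {V} e x y.
Arguments stationary R {V} e x.
Arguments first_passage R {V} e i j k.
Arguments never_reach R {V} e i j.
Arguments hitting_time R {V} e i j.
Arguments kemeny R {V} e i.

(* Main.v *)
Require Import Defs.
From mathcomp Require Import all_boot all_order all_algebra.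
From mathcomp Require Import all_classical all_reals all_analysis.
From mathcomp Require Import ring lra.
Set Implicit Arguments.
Unset Strict Implicit.
Unset Printing Implicit Defensive.
Import Order.TTheory GRing.Theory Num.Theory.
Import numFieldNormedType.Exports.
Local Open Scope ring_scope.

(** Write [P] for the transition operator of the walk and [pi] for its
    stationary distribution.  The proof avoids eigenvalues: Kemeny's constant is
    read off any Green function of the walk, that is, any kernel [X] with
    [X - P X = 1 - 1 pi].

    For fixed [j], the function [h i := (X j j - X i j) / pi j] vanishes at [j]
    and satisfies [h = 1 + P h] elsewhere, and by the minimum principle on a
    connected graph only the expected hitting time of [j] does so
    ([hitting_timeE]).  Summing [pi j * h i] over [j] gives
    [K = trace X - (row sum of X)] ([kemeny_green]); the row sums of [X] are
    harmonic, hence all equal, so the starting node does not matter.  A Green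
    function exists because [1 - P + 1 pi] is injective ([exists_green]).

    A Green function [X'] of the triangulated graph can be written down from one
    of the original graph ([qtri_greenP]).  The equation for [X'] at a new node
    only involves its two neighbours, which are old, so new nodes can be
    eliminated.  The walk leaves an old node [v] along an old edge with
    probability [1 / (q + 1)], and otherwise goes to a new node, from where it
    comes back to [v] or crosses to the other end with equal chances; thus the
    reduced operator is [(q + 2) / (2 (q + 1)) * (1 - P)], again a multiple of the
    Laplacian of the original graph.  The trace of [X'] then comes down to
    [trace X] and [trace (P X) = trace X - n + 1] ([qtri_green_trace]), its row
    sum to that of [X] ([qtri_green_row_sum]), both with the factor
    [2 (2 q + 1) / (q + 2)]. *)

(** * Counting edges and edge ends *)

Section Edges.
Variables (V : finType) (e : rel V).
Hypotheses (e_sym : symmetric e) (e_irr : irreflexive e).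

Lemma edge_neq x y : e x y -> x != y.
Proof. by apply: contraTneq => ->; rewrite e_irr. Qed.

Lemma edge_setP (E : {set V}) :
  reflect (exists2 p : V * V, e p.1 p.2 & E = [set p.1; p.2]%SET) (E \in edge_set e).
Proof.
by apply: (iffP imsetP) => -[p]; [rewrite inE|] => pe ->; exists p; rewrite ?inE.
Qed.

Lemma mem_edge_set x y : e x y -> [set x; y]%SET \in edge_set e.
Proof. by move=> exy; apply/edge_setP; exists (x, y). Qed.

Lemma edges_at x :
  [set E in edge_set e | x \in E]%SET =
  [set [set x; y]%SET | y in [set y | e x y]]%SET.
Proof.
apply/setP => E; rewrite inE; apply/andP/imsetP.
  case=> /edge_setP[[a b] /= eab ->]; rewrite !inE => /orP[] /eqP ->.
    by exists b; rewrite ?inE.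
  by exists a; rewrite ?inE 1?e_sym // finset.setUC.
case=> y; rewrite inE => exy ->.
by rewrite mem_edge_set // !inE eqxx.
Qed.

(** An edge at [x] is determined by its other end. *)
Lemma big_edges_at (T : Type) (idx : T) (op : Monoid.com_law idx) F x :
  \big[op/idx]_(E in edge_set e | x \in E) F E =
  \big[op/idx]_(y | e x y) F [set x; y]%SET.
Proof.
transitivity (\big[op/idx]_(E in [set E in edge_set e | x \in E]%SET) F E).
  by apply: eq_bigl => E; rewrite inE.
rewrite edges_at big_imset /=; first by apply: eq_bigl => y; rewrite inE.
move=> y z; rewrite !inE => exy exz eq_yz.
have: y \in [set x; z]%SET by rewrite -eq_yz !inE eqxx orbT.
by rewrite !inE eq_sym (negPf (edge_neq exy)) => /eqP.
Qed.

Lemma sum_edge_ends (M : nmodType) (F : V -> M) x y :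
  e x y -> \sum_(u in [set x; y]%SET) F u = F x + F y.
Proof.
by move=> exy; rewrite big_setU1 ?big_set1 //= inE edge_neq.
Qed.

Lemma card_edge E : E \in edge_set e -> #|E| = 2%N.
Proof. by case/edge_setP => -[x y] /= exy ->; rewrite cards2 edge_neq. Qed.

Lemma degreeE x : degree e x = #|[pred y | e x y]|.
Proof. by apply: eq_card => y; rewrite !inE. Qed.

Lemma degree_edges x : degree e x = (\sum_(E in edge_set e | x \in E) 1)%N.
Proof. by rewrite (big_edges_at _ (fun=> 1%N)) degreeE sum1_card. Qed.

(** Count the pairs of an edge and one of its ends in two ways. *)
Lemma handshake : (\sum_x degree e x = 2 * #|edge_set e|)%N.
Proof.
rewrite (eq_bigr (fun x => \sum_(E in edge_set e | x \in E) 1)%N); last first.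
  by move=> x _; rewrite degree_edges.
rewrite (exchange_big_dep (mem (edge_set e))) /=; last by move=> x E _ /andP[].
rewrite (eq_bigr (fun=> 2%N)) ?sum_nat_const ?(mulnC 2%N) // => E E_edge.
rewrite -[RHS](card_edge E_edge) -sum1_card; apply: eq_bigl => x.
by rewrite E_edge.
Qed.

Lemma degree_gt0 x : connected_graph e -> (0 < #|edge_set e|)%N -> (0 < degree e x)%N.
Proof.
move=> e_conn /card_gt0P[E /edge_setP[[a b] /= eab _]].
have [y exy] : exists y, e x y.
  have [->|xa] := eqVneq x a; first by exists b.
  have /connectP[[|y p] /=] := e_conn x a; last by case/andP; exists y.
  by move=> _ ax; rewrite ax eqxx in xa.
by apply/card_gt0P; exists y; rewrite inE.
Qed.

End Edges.

(** * The transition operator and the minimum principle *)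

Section Walk.
Variables (R : realType) (V : finType) (e : rel V).
Hypotheses (e_sym : symmetric e) (e_irr : irreflexive e).
Hypotheses (e_conn : connected_graph e) (e_gt0 : (0 < #|edge_set e|)%N).

Definition walk_mean (f : V -> R) x : R := \sum_y walk_step R e x y * f y.

Lemma walk_step_ge0 x y : 0 <= walk_step R e x y.
Proof. by rewrite /walk_step; case: ifP; rewrite ?invr_ge0 ?ler0n. Qed.

Lemma walk_meanE f x : walk_mean f x = (degree e x)%:R^-1 * \sum_(y | e x y) f y.
Proof.
rewrite /walk_mean mulr_sumr [RHS]big_mkcond /=; apply: eq_bigr => y _.
by rewrite /walk_step; case: (e x y); rewrite ?mul0r.
Qed.

Lemma degree_neq0 x : (degree e x)%:R != 0 :> R.
Proof. by rewrite pnatr_eq0 -lt0n degree_gt0. Qed.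

Lemma walk_mean_cst c x : walk_mean (fun=> c) x = c.
Proof.
rewrite walk_meanE sumr_const -degreeE -[c *+ _]mulr_natl mulKf //.
exact: degree_neq0.
Qed.

Lemma walk_meanD f g x :
  walk_mean (fun y => f y + g y) x = walk_mean f x + walk_mean g x.
Proof. by rewrite -big_split; apply: eq_bigr => y _; rewrite mulrDr. Qed.

Lemma walk_meanN f x : walk_mean (fun y => - f y) x = - walk_mean f x.
Proof. by rewrite -sumrN; apply: eq_bigr => y _; rewrite mulrN. Qed.

Lemma walk_meanB f g x :
  walk_mean (fun y => f y - g y) x = walk_mean f x - walk_mean g x.
Proof. by rewrite walk_meanD walk_meanN. Qed.

Lemma walk_meanZ c f x : walk_mean (fun y => c * f y) x = c * walk_mean f x.
Proof. by rewrite mulr_sumr; apply: eq_bigr => y _; rewrite mulrCA. Qed.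

Lemma walk_mean_sum (I : finType) (F : I -> V -> R) x :
  walk_mean (fun y => \sum_i F i y) x = \sum_i walk_mean (F i) x.
Proof.
by rewrite exchange_big; apply: eq_bigr => y _; rewrite mulr_sumr.
Qed.

Lemma ler_walk_mean f g x :
  (forall y, f y <= g y) -> walk_mean f x <= walk_mean g x.
Proof.
by move=> fg; apply: ler_sum => y _; rewrite ler_wpM2l ?walk_step_ge0.
Qed.

(** Minimum principle: a value of [f] below zero, if minimal, propagates to all
    neighbours, hence to [j] by connectedness. *)
Lemma superharmonic_ge0 (j : V) (f : V -> R) :
  0 <= f j -> (forall x, x != j -> walk_mean f x <= f x) -> forall x, 0 <= f x.
Proof.
move=> fj fsup.
have [a _ amin] := @arg_minP _ R V j predT f isT.
suff fa : 0 <= f a by move=> x; apply: le_trans fa (amin _ _).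
rewrite leNgt; apply/negP => fa0.
have step x y : e x y -> f x = f a -> f y = f a.
  move=> exy fx.
  have xj : x != j by apply: contraTneq fa0 => xj; rewrite -fx xj -leNgt.
  have term_ge0 z : z \in V -> 0 <= walk_step R e x z * (f z - f a).
    by rewrite mulr_ge0 ?walk_step_ge0 // subr_ge0 amin.
  have sum0 : \sum_z walk_step R e x z * (f z - f a) = 0.
    apply/eqP; rewrite eq_le sumr_ge0 // andbT.
    rewrite -/(walk_mean _ x) walk_meanB walk_mean_cst -fx subr_le0.
    exact: fsup.
  have /eqP := psumr_eq0P (fun z _ => term_ge0 z isT) sum0 (i := y) isT.
  rewrite /walk_step exy mulf_eq0 invr_eq0 (negPf (degree_neq0 x)) /= subr_eq0.
  by move/eqP.
have path_min p x : path e x p -> f x = f a -> f (last x p) = f a.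
  by elim: p x => //= y p IHp x /andP[exy pyp] fx; apply: IHp pyp (step _ _ exy fx).
have /connectP[p ap jp] := e_conn a j.
by move: fj; rewrite jp path_min // leNgt fa0.
Qed.

(** Uniqueness for the linear systems below, such as that of the hitting times
    of [j]. *)
Lemma harmonic_off_eq0 (j : V) (f : V -> R) :
  f j = 0 -> (forall x, x != j -> walk_mean f x = f x) -> forall x, f x = 0.
Proof.
move=> fj fharm x; apply/eqP; rewrite eq_le -oppr_ge0.
rewrite (@superharmonic_ge0 j (fun y => - f y)) ?fj ?oppr0 //=.
  by rewrite (@superharmonic_ge0 j f) ?fj // => y /fharm ->.
by move=> y /fharm yh; rewrite walk_meanN yh.
Qed.

Lemma harmonic_cst (f : V -> R) :
  (forall x, walk_mean f x = f x) -> forall x y, f x = f y.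
Proof.
move=> fharm x y; apply/eqP; rewrite -subr_eq0; apply/eqP.
apply: (@harmonic_off_eq0 y (fun z => f z - f y)); first by rewrite subrr.
by move=> z _; rewrite walk_meanB walk_mean_cst fharm.
Qed.

Lemma sum_stationary : \sum_x stationary R e x = 1.
Proof.
rewrite -mulr_suml -natr_sum handshake // natrM divff //.
by rewrite mulf_neq0 ?pnatr_eq0 // -lt0n.
Qed.

Lemma stationary_neq0 x : stationary R e x != 0.
Proof.
by rewrite mulf_neq0 ?degree_neq0 // invr_eq0 mulf_neq0 ?pnatr_eq0 // -lt0n.
Qed.

(** Invariance of the stationary distribution: [stationary x * walk_step x y] is
    the same for every edge, so the sum over neighbours can be reversed. *)
Lemma stationary_walk_mean (f : V -> R) :
  \sum_x stationary R e x * walk_mean f x = \sum_x stationary R e x * f x.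
Proof.
under eq_bigr => x _ do
  rewrite walk_meanE mulrA /stationary [X in X * _]mulrAC mulfV ?degree_neq0 // mul1r.
rewrite -mulr_sumr (exchange_big_dep predT) //=.
rewrite mulr_sumr; apply: eq_bigr => y _.
rewrite (eq_bigl (e y)); last by move=> x; rewrite e_sym.
rewrite sumr_const -degreeE -[f y *+ _]mulr_natl /stationary; ring.
Qed.

End Walk.

(** * First passage probabilities *)

Section FirstPassage.
Variables (R : realType) (V : finType) (e : rel V).

Lemma first_passage_ge0 (i j : V) k : 0 <= first_passage R e i j k.
Proof. by apply: sumr_ge0 => w _; apply: prodr_ge0 => t _; apply: walk_step_ge0. Qed.

Lemma first_passage0 (i j : V) : first_passage R e i j 0 = (i == j)%:R.
Proof.
rewrite /first_passage (eq_bigl (fun=> i == j)) => [|w]; last first.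
  by rewrite tuple0 /=; case: (i == j).
under eq_bigr => w _ do rewrite big_ord0.
case: eqVneq => _; last by rewrite big_pred0.
by rewrite big_const iter_addr addr0 card_tuple expn0.
Qed.

(** Condition on the first step of the walk. *)
Lemma first_passageS (i j : V) k :
  first_passage R e i j k.+1 =
  if i == j then 0 else walk_mean e (fun l => first_passage R e l j k) i.
Proof.
have cons_bij : bijective (fun p : V * k.-tuple V => [tuple of p.1 :: p.2]).
  exists (fun w => (thead w, [tuple of behead w])) => [[l w]|w].
    by congr pair; apply: val_inj.
  by rewrite -tuple_eta.
rewrite /first_passage (reindex _ (onW_bij _ cons_bij)) /=.
case: eqVneq => [->|ij]; first by rewrite big_pred0.
rewrite /walk_mean; under [RHS]eq_bigr => l _ do rewrite mulr_sumr.
rewrite pair_big_dep /=; apply: eq_big => [[l w]|[l w] _] //=.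
rewrite big_ord_recl tnth0 /=; congr (_ * _).
apply: eq_bigr => t _; rewrite tnthS add0n.
by rewrite (set_nth_default l) //= size_tuple ltnS ltnW.
Qed.

End FirstPassage.

(** * Hitting times and Green functions *)

Lemma exists_inverse (F : fieldType) (I : finType) (A : I -> I -> F) :
  (forall f : I -> F, (forall i, \sum_k A i k * f k = 0) -> forall k, f k = 0) ->
  exists B : I -> I -> F, forall i j, \sum_k A i k * B k j = (i == j)%:R.
Proof.
move=> Ainj; pose M : 'M[F]_#|I| := \matrix_(i, j) A (enum_val i) (enum_val j).
have M_unit : M \in unitmx.
  rewrite -unitmx_tr -row_free_unit; apply: inj_row_free => v vM.
  apply/rowP => k; rewrite mxE -[k]enum_valK.
  apply: (Ainj (fun x => v 0 (enum_rank x))) => i.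
  have /rowP/(_ (enum_rank i)) := vM; rewrite !mxE; apply: etrans.
  rewrite (reindex _ (onW_bij _ (enum_val_bij I))) /=; apply: eq_bigr => l _.
  by rewrite !mxE enum_rankK enum_valK mulrC.
exists (fun i j => invmx M (enum_rank i) (enum_rank j)) => i j.
have /matrixP/(_ (enum_rank i) (enum_rank j)) := mulmxV M_unit.
rewrite !mxE (inj_eq enum_rank_inj) => <-.
rewrite (reindex _ (onW_bij _ (enum_val_bij I))) /=; apply: eq_bigr => l _.
by rewrite !mxE enum_rankK enum_valK.
Qed.

Section HittingTime.
Variables (R : realType) (V : finType) (e : rel V).
Hypotheses (e_sym : symmetric e) (e_irr : irreflexive e).
Hypotheses (e_conn : connected_graph e) (e_gt0 : (0 < #|edge_set e|)%N).

Lemma cvg_walk_mean (u : nat -> V -> R) (h : V -> R) :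
  (forall y, u n y @[n --> \oo] --> h y)%classic ->
  forall x, (walk_mean e (u n) x @[n --> \oo] --> walk_mean e h x)%classic.
Proof.
move=> u_h x; rewrite /walk_mean.
apply: (@cvg_big R^o _ +%R) => [|y _]; first exact: add_continuous.
exact: cvgMl_tmp.
Qed.

(** Partial sums of first passage series obey the recursion of [u].  The bound
    [u n <= h] follows by induction, so [u] converges by monotonicity; its limit
    solves the same system as [h], and uniqueness identifies the two. *)
Lemma iterates_cvg (j : V) (u b : nat -> V -> R) (b' h : V -> R) :
  (forall x, 0 <= h x) -> (forall x, u 0%N x = 0) ->
  (forall x n, u n x <= u n.+1 x) ->
  (forall n, u n.+1 j = h j) ->
  (forall x n, x != j -> u n.+1 x = b n x + walk_mean e (u n) x) ->
  (forall x n, b n x <= b' x) ->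
  (forall x, b n x @[n --> \oo] --> b' x)%classic ->
  (forall x, x != j -> h x = b' x + walk_mean e h x) ->
  forall x, (u n x @[n --> \oo] --> h x)%classic.
Proof.
move=> h_ge0 u0 u_incr uj uS b_le b_cvg hS.
have u_le n : forall x, u n x <= h x.
  elim: n => [|n IHn] x; first by rewrite u0.
  have [->|xj] := eqVneq x j; first by rewrite uj.
  by rewrite uS // hS // lerD // ler_walk_mean.
pose l x := limn (u ^~ x).
have u_cvg x : (u n x @[n --> \oo] --> l x)%classic.
  apply: nondecreasing_is_cvgn; first exact/nondecreasing_seqP.
  by exists (h x) => _ [n _ <-].
have lS x : x != j -> l x = b' x + walk_mean e l x.
  move=> xj; have uS_cvg : (u n.+1 x @[n --> \oo] --> l x)%classic.
    by have := u_cvg x; rewrite -cvg_shiftS.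
  have uS_eq : (fun n => u n.+1 x) = (fun n => b n x + walk_mean e (u n) x).
    by apply/funext => n; rewrite uS.
  rewrite uS_eq in uS_cvg; apply: (cvg_unique _ uS_cvg) => //.
  by apply: cvgD => //; apply: cvg_walk_mean.
have lj : l j = h j.
  have uj_cvg : (u n.+1 j @[n --> \oo] --> l j)%classic.
    by have := u_cvg j; rewrite -cvg_shiftS.
  have uj_eq : (fun n => u n.+1 j) = (fun=> h j) by apply/funext => n; rewrite uj.
  by rewrite uj_eq in uj_cvg; apply: (cvg_unique _ uj_cvg) => //; apply: cvg_cst.
suff lh x : l x = h x by move=> x; rewrite -lh.
apply/eqP; rewrite -subr_eq0; apply/eqP.
apply: (harmonic_off_eq0 e_conn e_gt0 (f := fun y => l y - h y) (j := j)).
  by rewrite lj subrr.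
by move=> y yj; rewrite walk_meanB lS // hS //; ring.
Qed.

Let reach (j : V) n x : R := \sum_(0 <= k < n) first_passage R e x j k.

Let reachS j n x : x != j -> reach j n.+1 x = walk_mean e (reach j n) x.
Proof.
move=> xj; rewrite /reach big_nat_recl // first_passage0 (negPf xj) add0r.
under eq_bigr => k _ do rewrite first_passageS (negPf xj).
by rewrite exchange_big; apply: eq_bigr => y _; rewrite mulr_sumr.
Qed.

(** The walk reaches [j] almost surely: the probability of reaching [j] and the
    constant 1 are both harmonic off [j] and equal to 1 at [j]. *)
Lemma reach_cvg j x : (reach j n x @[n --> \oo] --> (1 : R))%classic.
Proof.
apply: (@iterates_cvg j (reach j) (fun=> cst 0) (cst 0) (cst 1)) => //=.
- by move=> y; rewrite /reach big_geq.
- by move=> y n; rewrite /reach big_nat_recr //= lerDl first_passage_ge0.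
- move=> n; rewrite /reach big_nat_recl // first_passage0 eqxx big1 ?addr0 // => k _.
  by rewrite first_passageS eqxx.
- by move=> y n yj; rewrite add0r reachS.
- by move=> y; apply: cvg_cst.
- by move=> y yj; rewrite add0r walk_mean_cst.
Qed.

(** Splitting off the first step, [k.+1 = 1 + k] turns the partial sums of
    expectations into those at the neighbours plus the probability of having
    arrived, which increases to 1. *)
Lemma mean_first_passage_cvg j (h : V -> R) :
  h j = 0 -> (forall x, x != j -> h x = 1 + walk_mean e h x) -> forall x,
  (\sum_(0 <= k < n) k%:R * first_passage R e x j k @[n --> \oo] --> h x)%classic.
Proof.
move=> hj hS x; pose u n y : R := \sum_(0 <= k < n) k%:R * first_passage R e y j k.
have reach_le1 n y : reach j n y <= 1.
  have reach_incr : {homo reach j ^~ y : n m / (n <= m)%N >-> n <= m}.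
    apply/nondecreasing_seqP => k.
    by rewrite /reach big_nat_recr //= lerDl first_passage_ge0.
  have := nondecreasing_cvgn_le reach_incr (cvgP _ (reach_cvg j y)) n.
  by rewrite (cvg_lim _ (reach_cvg j y)).
have h_ge0 y : 0 <= h y.
  apply: (superharmonic_ge0 e_conn e_gt0 (j := j)); first by rewrite hj.
  by move=> z zj; rewrite [leRHS]hS // lerDr ler01.
have uS y n : y != j -> u n.+1 y = walk_mean e (reach j n) y + walk_mean e (u n) y.
  move=> yj; rewrite /u big_nat_recl // mul0r add0r -walk_meanD.
  under eq_bigr => k _ do rewrite first_passageS (negPf yj) -walk_meanZ.
  rewrite exchange_big; apply: eq_bigr => z _.
  rewrite -mulr_sumr -big_split /=; congr (_ * _); apply: eq_bigr => k _.
  by rewrite -natr1; ring.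
apply: (@iterates_cvg j u (fun n => walk_mean e (reach j n)) (cst 1) h) => //=.
- by move=> y; rewrite /u big_geq.
- by move=> y n; rewrite /u big_nat_recr //= lerDl mulr_ge0 ?first_passage_ge0.
- move=> n; rewrite /u big_nat_recl // mul0r add0r hj big1 // => k _.
  by rewrite first_passageS eqxx mulr0.
- move=> y n; rewrite -[leRHS](walk_mean_cst e_conn e_gt0 1 y).
  exact: ler_walk_mean.
- move=> y; have := @cvg_walk_mean (reach j) (cst 1) (reach_cvg j) y.
  by rewrite walk_mean_cst.
Qed.

Lemma eseries_EFin (a : nat -> R) (l : R) :
  (\sum_(0 <= k < n) a k @[n --> \oo] --> l)%classic ->
  (\sum_(0 <= k <oo) (a k)%:E = l%:E)%E.
Proof.
move=> a_l; apply: cvg_lim => //.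
rewrite (_ : (fun n => _) = EFin \o (fun n => \sum_(0 <= k < n) a k)).
  by apply: cvg_EFin; [apply: nearW | exact: a_l].
by apply/funext => n; rewrite sumEFin.
Qed.

Lemma hitting_timeE j (h : V -> R) :
  h j = 0 -> (forall x, x != j -> h x = 1 + walk_mean e h x) -> forall x,
  hitting_time R e x j = (h x)%:E.
Proof.
move=> hj hS x; rewrite /hitting_time /never_reach.
rewrite (eseries_EFin (reach_cvg j x)) -EFinB subrr mule0 adde0.
exact/eseries_EFin/mean_first_passage_cvg.
Qed.

(** [X] inverts the Laplacian [1 - P] up to the projection on constants: it is
    the group inverse of [1 - P] up to a constant added to each column. *)
Definition green (X : V -> V -> R) : Prop := forall x j,
  X x j - walk_mean e (X ^~ j) x = (x == j)%:R - stationary R e j.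

Lemma green_row_sum X : green X -> forall x y, \sum_j X x j = \sum_j X y j.
Proof.
move=> GX; apply: (harmonic_cst e_conn e_gt0 (f := fun x => \sum_j X x j)) => x.
apply/eqP; rewrite eq_sym -subr_eq0 walk_mean_sum -sumrB; apply/eqP.
under eq_bigr => j _ do rewrite GX.
rewrite sumrB sum_stationary // (bigD1 x) //= eqxx big1 ?addr0 ?subrr // => j.
by rewrite eq_sym => /negPf ->.
Qed.

(** For a given [j], [(X j j - X i j) / stationary j] solves the system that
    characterizes the hitting times of [j]. *)
Lemma kemeny_green X : green X -> forall i,
  kemeny R e i = (\sum_j X j j - \sum_j X i j)%:E.
Proof.
move=> GX i; rewrite /kemeny -sumrB -sumEFin; apply: eq_bigr => j _.
have pi_neq0 := stationary_neq0 R e_conn e_gt0 j.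
rewrite (@hitting_timeE j (fun x => (stationary R e j)^-1 * (X j j - X x j))).
- by rewrite -EFinM mulrA divff // mul1r.
- by rewrite subrr mulr0.
move=> x xj; rewrite walk_meanZ walk_meanB walk_mean_cst //.
have := GX x j; rewrite (negPf xj) /= => GXxj.
apply/eqP; rewrite -subr_eq0; apply/eqP.
have -> : walk_mean e (X ^~ j) x = X x j + stationary R e j by lra.
by field.
Qed.

(** Adding the projection [1 pi] makes [1 - P] invertible: averaging
    [f - P f + pi f = 0] against [pi] gives [pi f = 0], so [f] is harmonic, hence
    constant, hence zero.  The same averaging applied to the inverse [Z] shows
    that [pi Z = pi], so that [Z] is a Green function. *)
Lemma exists_green : exists X, green X.
Proof.
pose A (x y : V) : R := (x == y)%:R - walk_step R e x y + stationary R e y.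
have AE f x : \sum_y A x y * f y =
    f x - walk_mean e f x + \sum_y stationary R e y * f y.
  rewrite /walk_mean; under eq_bigr => y _ do rewrite mulrDl mulrBl.
  rewrite big_split sumrB /=; congr (_ - _ + _).
  rewrite (bigD1 x) //= eqxx mul1r big1 ?addr0 // => y.
  by rewrite eq_sym => /negPf ->; rewrite mul0r.
have sum_piA f : \sum_x stationary R e x * (\sum_y A x y * f y) =
    \sum_y stationary R e y * f y.
  under eq_bigr => x _ do rewrite AE mulrDr mulrBr.
  rewrite big_split sumrB /= stationary_walk_mean // subrr add0r -mulr_suml.
  by rewrite sum_stationary // mul1r.
have [f Af0 k|Z AZ] := @exists_inverse R V A.
  have pif0 : \sum_y stationary R e y * f y = 0.
    by rewrite -sum_piA big1 // => x _; rewrite Af0 mulr0.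
  have f_harm x : walk_mean e f x = f x.
    by have := Af0 x; rewrite AE pif0 addr0 => /subr0_eq.
  rewrite -pif0; under eq_bigr => y _ do rewrite (harmonic_cst e_conn e_gt0 f_harm y k).
  by rewrite -mulr_suml sum_stationary // mul1r.
exists Z => x j; have := AZ x j; rewrite AE -sum_piA => <-.
under [X in _ + X - _]eq_bigr => y _ do rewrite AZ.
rewrite (bigD1 j) //= eqxx mulr1 big1 ?addr0 ?addrK // => y /negPf ->.
by rewrite mulr0.
Qed.

End HittingTime.

(** * The triangulated graph *)

Section Triangulation.
Variables (V : finType) (e : rel V) (q : nat).
Hypotheses (e_sym : symmetric e) (e_irr : irreflexive e).

Lemma qtri_sym : symmetric (qtri e q).
Proof. by move=> [u|[E a]] [v|[E' a']] //=; rewrite e_sym. Qed.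

Lemma qtri_irr : irreflexive (qtri e q).
Proof. by move=> [u|[E a]] //=; rewrite e_irr. Qed.

Lemma qtri_conn : connected_graph e -> connected_graph (qtri e q).
Proof.
move=> e_conn.
have VV u v : connect (qtri e q) (inl u) (inl v).
  have /connectP[p up ->] := e_conn u v.
  elim: p u up => //= w p IHp u /andP[euw wp].
  by apply: connect_trans (IHp w wp); apply: connect1.
have end_of (z : {E : {set V} | E \in edge_set e} * 'I_q) : exists u, u \in val z.1.
  by apply/card_gt0P; rewrite (card_edge e_irr (valP z.1)).
have MV z v : connect (qtri e q) (inr z) (inl v).
  have [u uz] := end_of z; apply: connect_trans (VV u v); apply: connect1.
  by case: z uz.
have qsym := sym_connect_sym qtri_sym.
case=> [u|z] [v|z'] //; first by rewrite qsym.
have [u _] := end_of z; apply: connect_trans (MV z u) _.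
by rewrite qsym.
Qed.

Lemma big_qtri_old (T : Type) (idx : T) (op : Monoid.law idx) F v :
  \big[op/idx]_(y | qtri e q (inl v) y) F y =
  op (\big[op/idx]_(u | e v u) F (inl u))
     (\big[op/idx]_(y : {E | E \in edge_set e} * 'I_q | v \in val y.1) F (inr y)).
Proof. by rewrite big_sumType /=; congr (op _ _); apply: eq_bigl => -[E a]. Qed.

Lemma big_qtri_new (T : Type) (idx : T) (op : Monoid.law idx) F
    (z : {E | E \in edge_set e} * 'I_q) :
  \big[op/idx]_(y | qtri e q (inr z) y) F y =
  \big[op/idx]_(u in val z.1) F (inl u).
Proof.
rewrite big_sumType /= [X in op _ X]big_pred0 ?Monoid.mulm1; last by case: z.
by apply: eq_bigl; case: z.
Qed.

Lemma sum_midpoints (M : nmodType) (P : pred {set V}) (F : {set V} -> M) :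
  \sum_(y : {E | E \in edge_set e} * 'I_q | P (val y.1)) F (val y.1) =
  (\sum_(E in edge_set e | P E) F E) *+ q.
Proof.
rewrite [LHS]big_mkcond [X in _ = X *+ q]big_mkcondr /= [X in _ = X *+ q]big_sub.
rewrite -(pair_bigA _ (fun E _ => if P (val E) then F (val E) else 0)) /=.
by rewrite -sumrMnl; apply: eq_bigr => E _; rewrite sumr_const card_ord.
Qed.

Lemma card_midpoints : #|{: {E | E \in edge_set e} * 'I_q}| = (#|edge_set e| * q)%N.
Proof.
by rewrite card_prod card_ord card_sig.
Qed.

Lemma qtri_degree_old v : degree (qtri e q) (inl v) = ((q + 1) * degree e v)%N.
Proof.
rewrite degreeE -sum1_card big_qtri_old sum1_card -degreeE /=.
rewrite [X in addn _ X](sum_midpoints (fun E => v \in E) (fun=> 1%N)).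
by rewrite -degree_edges // -mulr_natr natn addnC mulnDl mul1n mulnC.
Qed.

Lemma qtri_degree_new z : degree (qtri e q) (inr z) = 2%N.
Proof.
by rewrite degreeE -sum1_card big_qtri_new sum1_card (card_edge e_irr (valP z.1)).
Qed.

(** Through the degrees, by the handshake identity in the triangulated graph. *)
Lemma card_qtri_edges :
  #|edge_set (qtri e q)| = ((2 * q + 1) * #|edge_set e|)%N.
Proof.
apply/eqP; rewrite -(@eqn_pmul2l 2) //; apply/eqP.
rewrite -(handshake qtri_sym qtri_irr) big_sumType /=.
under eq_bigr => v _ do rewrite qtri_degree_old.
under [X in addn _ X]eq_bigr => z _ do rewrite qtri_degree_new.
rewrite -big_distrr /= handshake // sum_nat_const card_midpoints; ring.
Qed.

End Triangulation.

(** * Green function of the triangulated graph *)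

Section TriangulationGreen.
Variables (R : realType) (V : finType) (e : rel V) (q : nat).
Hypotheses (e_sym : symmetric e) (e_irr : irreflexive e).
Hypotheses (e_conn : connected_graph e) (e_gt0 : (0 < #|edge_set e|)%N).

Local Notation midpoint := ({E | E \in edge_set e} * 'I_q)%type.
Local Notation deg x := ((degree e x)%:R : R).
Local Notation Q := (q%:R : R).

Lemma qtri_edges_gt0 : (0 < #|edge_set (qtri e q)|)%N.
Proof. by rewrite card_qtri_edges // muln_gt0 addn1 /=. Qed.

Let Q1_neq0 : Q + 1 != 0. Proof. by rewrite natr1 pnatr_eq0. Qed.
Let Q2_neq0 : Q + 2 != 0. Proof. by rewrite -natrD pnatr_eq0 addn2. Qed.
Let QQ1_neq0 : 2 * Q + 1 != 0. Proof. by rewrite -natrM natr1 pnatr_eq0. Qed.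
Let m_neq0 : #|edge_set e|%:R != 0 :> R. Proof. by rewrite pnatr_eq0 -lt0n. Qed.
Let deg_neq0 x : deg x != 0. Proof. exact: degree_neq0. Qed.

Lemma qtri_stationary_old v :
  stationary R (qtri e q) (inl v) = (Q + 1) / (2 * Q + 1) * stationary R e v.
Proof.
rewrite /stationary qtri_degree_old // card_qtri_edges // !(natrM, natrD).
by field; rewrite m_neq0 QQ1_neq0.
Qed.

Lemma qtri_stationary_new z :
  stationary R (qtri e q) (inr z) = ((2 * Q + 1) * #|edge_set e|%:R)^-1.
Proof.
rewrite /stationary qtri_degree_new // card_qtri_edges // !(natrM, natrD).
by field; rewrite m_neq0 QQ1_neq0.
Qed.

Lemma qtri_walk_mean_old g v :
  walk_mean (qtri e q) g (inl v) =
  ((Q + 1) * deg v)^-1 * (\sum_(u | e v u) g (inl u)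
                          + \sum_(y : midpoint | v \in val y.1) g (inr y)) :> R.
Proof. by rewrite walk_meanE qtri_degree_old // big_qtri_old natrM natrD. Qed.

Lemma qtri_walk_mean_new g z :
  walk_mean (qtri e q) g (inr z) = (\sum_(u in val z.1) g (inl u)) / 2 :> R.
Proof. by rewrite walk_meanE qtri_degree_new // big_qtri_new mulrC. Qed.

Lemma sum_nbrs (f : V -> R) v : \sum_(u | e v u) f u = deg v * walk_mean e f v.
Proof. by rewrite walk_meanE mulVKf. Qed.

(** Going from [v] to a midpoint and on to a random end leads back to [v] half of
    the time, and otherwise makes one step of the original walk. *)
Lemma sum_midpoints_ends (f : V -> R) v :
  \sum_(y : midpoint | v \in val y.1) \sum_(u in val y.1) f u =
  Q * deg v * (f v + walk_mean e f v).
Proof.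
rewrite (sum_midpoints _ _ (fun E => v \in E) (fun E : {set V} => \sum_(u in E) f u)).
rewrite big_edges_at // -[LHS]mulr_natl -mulrA; congr (_ * _).
rewrite mulrDr -sum_nbrs (eq_bigr (fun y => f v + f y)); last first.
  by move=> y evy; rewrite (sum_edge_ends e_irr).
by rewrite big_split sumr_const -degreeE mulr_natl.
Qed.

Lemma sum_midpoints_cst (c : R) v :
  \sum_(y : midpoint | v \in val y.1) c = Q * deg v * c.
Proof.
rewrite (sum_midpoints _ _ (fun E => v \in E) (fun=> c)) big_edges_at //.
by rewrite sumr_const -degreeE -[LHS]mulr_natl -[c *+ _]mulr_natl mulrA.
Qed.

(** The right-hand side left at the old nodes when the new nodes are eliminated
    from [f - P' f = (unit mass at w)], [P'] being the transition operator of the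
    triangulated graph: the mass at a new node [z] is passed on to each end [u]
    with weight [P' u z]. *)
Definition qtri_source (w : qtri_node e q) (u : V) : R :=
  match w with
  | inl v => (u == v)%:R
  | inr z => if u \in val z.1 then ((Q + 1) * deg u)^-1 else 0
  end.

Lemma qtri_sourceE w v :
  qtri_source w v = (inl v == w)%:R
    + ((Q + 1) * deg v)^-1 * \sum_(y : midpoint | v \in val y.1) (inr y == w)%:R.
Proof.
case: w => [u|z] /=.
  by rewrite big1 // mulr0 addr0.
rewrite add0r big_mkcond (bigD1 z) //= eqxx big1 => [|y /negPf yz].
  by case: ifP; rewrite addr0 ?mulr1 ?mulr0.
by rewrite (inj_eq (@inr_inj _ _)) yz if_same.
Qed.

(** By invariance, the stationary mass of [w] in the triangulated graph is the
    mean of its source over the old nodes, where the stationary distribution is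
    [stationary R e] scaled by the total mass [(Q + 1) / (2 * Q + 1)]. *)
Lemma sum_stationary_qtri_source w :
  \sum_u stationary R e u * qtri_source w u =
  (2 * Q + 1) / (Q + 1) * stationary R (qtri e q) w.
Proof.
case: w => [v|z] /=.
  rewrite (bigD1 v) //= eqxx mulr1 big1 ?addr0 => [|u /negPf ->]; last exact: mulr0.
  by rewrite qtri_stationary_old; field; rewrite Q1_neq0 QQ1_neq0.
rewrite (eq_bigr (fun u => if u \in val z.1 then
    (2 * #|edge_set e|%:R * (Q + 1))^-1 else 0)); last first.
  move=> u _; case: ifP => _; last exact: mulr0.
  by rewrite /stationary; field; rewrite m_neq0 Q1_neq0 deg_neq0.
rewrite -big_mkcond sumr_const (card_edge e_irr (valP z.1)) qtri_stationary_new.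
by rewrite -mulr_natl; field; rewrite m_neq0 Q1_neq0 QQ1_neq0.
Qed.

Lemma sum_qtri_source u : \sum_w qtri_source w u = (2 * Q + 1) / (Q + 1).
Proof.
rewrite big_sumType /= -big_mkcond sum_midpoints_cst.
rewrite (bigD1 u) //= eqxx big1 => [|v]; last by rewrite eq_sym => /negPf ->.
by rewrite /= addr0; field; rewrite Q1_neq0 deg_neq0.
Qed.

Variable X : V -> V -> R.
Hypothesis GX : green e X.

(** The factor inverts the coefficient [(Q + 2) / (2 * (Q + 1))] of the Laplacian
    of the original graph in the system reduced to the old nodes. *)
Definition qtri_green_old v w : R :=
  2 * (Q + 1) / (Q + 2) * \sum_u X v u * qtri_source w u.

(** At a new node the Green equation gives the value directly from those at the
    two ends. *)
Definition qtri_green (x w : qtri_node e q) : R :=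
  match x with
  | inl v => qtri_green_old v w
  | inr z => (\sum_(u in val z.1) qtri_green_old u w) / 2 + (x == w)%:R
             - stationary R (qtri e q) w
  end.

Lemma qtri_green_old_laplacian v w :
  qtri_green_old v w - walk_mean e (qtri_green_old ^~ w) v =
  2 * (Q + 1) / (Q + 2) *
  (qtri_source w v - (2 * Q + 1) / (Q + 1) * stationary R (qtri e q) w).
Proof.
rewrite /qtri_green_old walk_meanZ -mulrBr walk_mean_sum -sumrB.
rewrite -sum_stationary_qtri_source; congr (_ * _).
transitivity (\sum_u ((v == u)%:R - stationary R e u) * qtri_source w u).
  apply: eq_bigr => u _; rewrite -GX mulrBl; congr (_ - _).
  rewrite mulrC -walk_meanZ; apply: eq_bigr => y _.
  by rewrite [qtri_source _ _ * _]mulrC.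
under eq_bigr => u _ do rewrite mulrBl.
rewrite sumrB (bigD1 v) //= eqxx mul1r big1 ?addr0 // => u.
by rewrite eq_sym => /negPf ->; rewrite mul0r.
Qed.

Lemma qtri_greenP : green (qtri e q) qtri_green.
Proof.
move=> [v|z] w; last by rewrite qtri_walk_mean_new /=; ring.
rewrite qtri_walk_mean_old /= sumrB big_split /= -mulr_suml sum_midpoints_ends.
rewrite sum_midpoints_cst sum_nbrs.
have := qtri_green_old_laplacian v w; rewrite qtri_sourceE.
move: (walk_mean _ _ _) (qtri_green_old v w) (stationary _ _ _) => PY Y p.
move: (\sum_(y | _) _) (nat_of_bool _) => s d /(canRL (subKr _)) ->.
by field; rewrite Q1_neq0 deg_neq0 Q2_neq0.
Qed.

Lemma qtri_green_row_sum v :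
  \sum_w qtri_green (inl v) w = 2 * (2 * Q + 1) / (Q + 2) * \sum_j X v j.
Proof.
rewrite /= /qtri_green_old -mulr_sumr exchange_big /=.
under eq_bigr => u _ do rewrite -mulr_sumr sum_qtri_source.
by rewrite -mulr_suml; field; rewrite Q1_neq0 Q2_neq0.
Qed.

(** Up to constants, the diagonal entries at the midpoints add up, by
    [sum_midpoints_ends], to a combination of the traces of [X] and [P X]; the
    trace of [P X] is [\sum_j X j j - #|V| + 1] by the Green equation. *)
Lemma qtri_green_trace :
  \sum_w qtri_green w w = 2 * (2 * Q + 1) / (Q + 2) * (\sum_j X j j)
    + #|edge_set e|%:R * Q - Q / (2 * Q + 1) - Q * (#|V|%:R - 1) / (Q + 2).
Proof.
have old_old v : qtri_green (inl v) (inl v) = 2 * (Q + 1) / (Q + 2) * X v v.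
  rewrite /= /qtri_green_old (bigD1 v) //= eqxx mulr1 big1 ?addr0 // => u /negPf ->.
  exact: mulr0.
have trace_new : \sum_(z : midpoint) \sum_(u in val z.1) qtri_green_old u (inr z) =
    2 * Q / (Q + 2) * (2 * (\sum_j X j j) - #|V|%:R + 1).
  transitivity (2 * (Q + 1) / (Q + 2) * \sum_w ((Q + 1) * deg w)^-1 *
      \sum_(z : midpoint | w \in val z.1) \sum_(u in val z.1) X u w).
    rewrite mulr_sumr.
    under [RHS]eq_bigr => w _ do rewrite big_mkcond /= !mulr_sumr.
    rewrite exchange_big /=; apply: eq_bigr => z _.
    rewrite -mulr_sumr /qtri_green_old -mulr_sumr exchange_big; congr (_ * _).
    apply: eq_bigr => w _ /=; case: ifP => _; last first.
      by rewrite mulr0 big1 // => u _; rewrite mulr0.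
    by rewrite mulr_sumr; apply: eq_bigr => u _; rewrite mulrC.
  under eq_bigr => w _ do rewrite sum_midpoints_ends.
  rewrite (eq_bigr (fun w => Q / (Q + 1) * (2 * X w w - 1 + stationary R e w))).
    rewrite -mulr_sumr big_split sumrB /= sum_stationary // -mulr_sumr sumr_const.
    by field; rewrite Q1_neq0 Q2_neq0.
  move=> w _; have := GX w w; rewrite eqxx /= => GXww.
  have -> : walk_mean e (X ^~ w) w = X w w - 1 + stationary R e w by lra.
  by field; rewrite Q1_neq0 deg_neq0.
rewrite big_sumType /= (eq_bigr _ (fun v _ => old_old v)) -mulr_sumr.
under [X in _ + X]eq_bigr => z _ do rewrite eqxx qtri_stationary_new.
rewrite sumrB big_split /= -mulr_suml trace_new !sumr_const card_midpoints.
rewrite -[_^-1 *+ _]mulr_natl natrM.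
by field; rewrite m_neq0 QQ1_neq0 Q2_neq0.
Qed.

End TriangulationGreen.

(** * Kemeny's constant of the triangulated graph *)

Theorem theorem4 (R : realType) (V : finType) (e : rel V)
    (e_sym : symmetric e) (e_irr : irreflexive e) (e_conn : connected_graph e)
    (n m q : nat) (n_def : n = #|V|) (m_def : m = #|edge_set e|)
    (m_gt0 : (0 < m)%N) (q_gt0 : (0 < q)%N)
    (i : V) (x : qtri_node e q) :
  (kemeny R (qtri e q) x =
   ((4 * q%:R + 2) / (q%:R + 2))%:E * kemeny R e i
   + ((q%:R ^+ 2 + (4 * n%:R - 1) * q%:R + 2 * n%:R)
        / ((q%:R + 2) * (2 * q%:R + 1))
      + m%:R * q%:R - n%:R)%:E)%E.
Proof.
rewrite n_def; rewrite {}m_def in m_gt0 *.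
have [X GX] := exists_green R e_sym e_irr e_conn m_gt0.
have GX' := qtri_greenP e_sym e_irr e_conn m_gt0 GX (q := q).
have qtri_gt0 := qtri_edges_gt0 q e_sym e_irr m_gt0.
have q_conn := qtri_conn (q := q) e_sym e_irr e_conn.
rewrite (kemeny_green e_conn m_gt0 GX).
rewrite (kemeny_green q_conn qtri_gt0 GX').
rewrite (green_row_sum (qtri_sym e_sym) (qtri_irr e_irr) q_conn qtri_gt0 GX' x (inl i)).
rewrite qtri_green_trace // qtri_green_row_sum // -EFinM -EFinD; congr (_%:E).
have Q2_neq0 : q%:R + 2 != 0 :> R by rewrite -natrD pnatr_eq0 addn2.
have QQ1_neq0 : 2 * q%:R + 1 != 0 :> R by rewrite -natrM natr1 pnatr_eq0.
by field; rewrite Q2_neq0 QQ1_neq0.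
Qed.
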